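(* Let $\Phi\in\mathbb{P}_{d-1}(\mathbb{R}^{b\times b})$ be a matrix polynomial. Suppose that the matrices $B_1,\dots,B_d\in\mathbb{R}^{b\times b}$, with spectral decompositions $B_i=\Omega_i^{-1}\Lambda_i\Omega_i$ ($\Lambda_i$ real diagonal), have disjoint real spectra contained in $[\lambda_{\min}^{(\mathsf{cl})},\lambda_{\max}^{(\mathsf{cl})}]$. Assume that the block Vandermonde matrix $\mathsf{Van}\in\mathbb{R}^{bd\times bd}$ with $(i,j)$ block $B_i^{j-1}$ ($1\le i,j\le d$) is nonsingular, and let $F_1,\dots,F_d$ be the fundamental matrix polynomials associated with $B_1,\dots,B_d$. Then $$\Phi(\lambda I)=\sum_{k=1}^dF_k(\lambda I)\Phi(B_k)\qquad\forall\,\lambda\in\mathbb{R}.$$ Additionally, assume that the product expressions for $F_k$ given in the context are well-defined for $1\le k\le d$, that is, all the matrices $S_{i,d}^{(k)}$ ($1\le i,k\le d$) are nonsingular. Then for any $\lambda\notin[\lambda_{\min}^{(\mathsf{cl})},\lambda_{\max}^{(\mathsf{cl})}]$, it holds that $$\|\Phi(\lambda I)\|\le\sqrt d\cdot\left\|\begin{bmatrix}\Phi(B_1)\\ \vdots\\ \Phi(B_d)\end{bmatrix}\right\|\cdot\max_{1\le k\le d}\|F_k(\lambda I)\|$$ and $$\max_{1\le k\le d}\|F_k(\lambda I)\|^{\frac1{d-1}}\le\frac{\max\{\lambda_{\max}^{(\mathsf{cl})}-\lambda,\ \lambda-\lambda_{\min}^{(\mathsf{cl})}\}}{\min\limits_{\substack{1\le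 i\ne j\le d\\ \lambda_i\in\Lambda_i,\ \lambda_j\in\Lambda_j}}|\lambda_i-\lambda_j|}\cdot\chi_{\mathsf{mono}}\,\chi_{\mathsf{coef}},$$ with $\chi_{\mathsf{mono}},\chi_{\mathsf{coef}}$ as defined in the context.
   Context: $\|\cdot\|$ is the spectral norm; $\lambda$ is real; $\lambda_i\in\Lambda_i$ means that $\lambda_i$ is a diagonal entry of $\Lambda_i$. For non-commuting matrices the product is taken in increasing index order: $\prod_{i=2}^{d}A_i=A_2A_3\cdots A_d$. A matrix polynomial of degree at most $r$ is a map $\Phi(X)=C_0+XC_1+\dots+X^rC_r$ on $\mathbb{R}^{b\times b}$ with $C_i\in\mathbb{R}^{b\times b}$ (coefficients to the right of the variable); the set of these is $\mathbb{P}_r(\mathbb{R}^{b\times b})$. When $\mathsf{Van}$ is nonsingular, the fundamental matrix polynomials are the unique $F_1,\dots,F_d\in\mathbb{P}_{d-1}(\mathbb{R}^{b\times b})$ with $F_i(B_j)=\delta_{ij}I$ for all $1\le i,j\le d$ ($\delta_{ij}$ the Kronecker delta). Recursive construction. For $1\le k\le d$ let $(\Omega_i^{(k)},B_i^{(k)},\Lambda_i^{(k)})$ be $(\Omega_k,B_k,\Lambda_k)$ if $i=1$, $(\Omega_{i-1},B_{i-1},\Lambda_{i-1})$ if $2\le i\le k$, and $(\Omega_i,B_i,\Lambda_i)$ if $k+1\le i\le d$. For each $i=d,d-1,\dots,1$ define recursively $S_{i,i}^{(k)}:=I_b$, $S_{i,j}^{(k)}:=B_i^{(k)}S_{i,j-1}^{(k)}-S_{i,j-1}^{(k)}\widehat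 B_j^{(k)}$ for $j=i+1,\dots,d$, then $\widehat\Omega_i^{(k)}:=\Omega_i^{(k)}S_{i,d}^{(k)}$ and $\widehat B_i^{(k)}:=(\widehat\Omega_i^{(k)})^{-1}\Lambda_i^{(k)}\widehat\Omega_i^{(k)}$. The product expression for $F_k$ is $$F_k(\lambda I)=\Bigl(\prod_{i=2}^{d}\bigl(\lambda I-\widehat B_i^{(k)}\bigr)\Bigr)\bigl(S_{1,d}^{(k)}\bigr)^{-1}\qquad\forall\,\lambda\in\mathbb{R}.$$ Growth quantities: $$\chi_{\mathsf{mono}}^{(k)}:=\max_{2\le i\le d}\Bigl\{\frac{\|\lambda_{\min}^{(\mathsf{cl})}I-\widehat B_i^{(k)}\|}{\|\lambda_{\min}^{(\mathsf{cl})}I-\Lambda_i^{(k)}\|},\ \frac{\|\lambda_{\max}^{(\mathsf{cl})}I-\widehat B_i^{(k)}\|}{\|\lambda_{\max}^{(\mathsf{cl})}I-\Lambda_i^{(k)}\|},\ 1\Bigr\},$$ $$\chi_{\mathsf{coef}}^{(k)}:=\bigl\|(S_{1,d}^{(k)})^{-1}\bigr\|^{\frac1{d-1}}\min_{\substack{2\le i\le d\\ \lambda_1^{(k)}\in\Lambda_1^{(k)},\ \lambda_i^{(k)}\in\Lambda_i^{(k)}}}|\lambda_1^{(k)}-\lambda_i^{(k)}|,$$ $$\chi_{\mathsf{mono}}:=\max_{1\le k\le d}\chi_{\mathsf{mono}}^{(k)},\qquad \chi_{\mathsf{coef}}:=\max_{1\le k\le d}\chi_{\mathsf{coef}}^{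(k)}.$$
   Formalization: The recursion for S_{i,d}^{(k)} is run over j = d, d−1, …, i+1 (product for F_k in decreasing index order) instead of j = i+1, …, d; with the order as written the last inequality fails for some nodes with d = 3, b = 2. The last inequality is stated for d ≥ 2. *)

(* Defs.v *)
From HB Require Import structures.
From mathcomp Require Import all_boot all_order all_algebra.
From mathcomp Require Import classical_sets reals exp.

Set Implicit Arguments.
Unset Strict Implicit.
Unset Printing Implicit Defensive.

Import Order.TTheory GRing.Theory Num.Theory.

Local Open Scope classical_set_scope.
Local Open Scope ring_scope.

Definition l2norm (R : realType) (n : nat) (x : 'cV[R]_n) : R :=
  Num.sqrt (\sum_i x i 0 ^+ 2).

Definition spectral_norm (R : realType) (m n : nat) (A : 'M[R]_(m, n)) : R :=
  sup [set l2norm (A *m x) | x in [set x : 'cV[R]_n | l2norm x <= 1]].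

Definition spectrum (R : realType) (b : nat) (A : 'M[R]_b) : set R :=
  [set a | eigenvalue A a].

(* Matrix polynomials of degree at most r, coefficients to the right of the
   variable. *)
Definition matrix_poly (R : realType) (b r : nat) : set ('M[R]_b -> 'M[R]_b) :=
  [set Phi | exists C : 'I_r.+1 -> 'M[R]_b,
     forall X, Phi X = \sum_(i < r.+1) X ^+ i *m C i].

Definition block_vandermonde (R : realType) (b d : nat) (B : 'I_d -> 'M[R]_b) :
    'M[R]_(\sum_(i < d) b) :=
  \mxblock_(i < d, j < d) (B i ^+ j).

Definition fundamental (R : realType) (b d : nat) (B : 'I_d -> 'M[R]_b)
    (F : 'I_d -> 'M[R]_b -> 'M[R]_b) : Prop :=
  (forall i, matrix_poly d.-1 (F i)) /\
  (forall i j, F i (B j) = if i == j then 1%:M else 0).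

(* X |-> value at X (coefficients to the right) of the matrix polynomial
     (x I - A_m) ... (x I - A_2) (x I - A_1),   where s = [:: A_1; ...; A_m].
   The factor A_m, leftmost in the product, is absorbed first: appending a
   factor (x I - A) on the right of a polynomial with value S at X produces a
   polynomial with value X S - S A at X. *)
Definition factor_eval (R : realType) (b : nat) (s : seq 'M[R]_b)
    (X : 'M[R]_b) : 'M[R]_b :=
  foldr (fun A S => X *m S - S *m A) 1%:M s.

Section Construction.
Variables (R : realType) (b d : nat).
Variables (Omega : 'I_d -> 'M[R]_b) (Lambda : 'I_d -> 'rV[R]_b).
Variable B : 'I_d -> 'M[R]_b.

Definition nodes (k : 'I_d) : seq 'I_d := k :: [seq i <- enum 'I_d | i != k].

(* Positions are counted from 0: the position i of the code is the index i + 1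
   of the mathematical construction. *)
Definition node (k : 'I_d) (i : nat) : 'I_d := nth k (nodes k) i.

Fixpoint hats_of (s : seq 'I_d) : seq 'M[R]_b :=
  if s is i :: s' then
    let Omega_hat := Omega i *m factor_eval (hats_of s') (B i) in
    invmx Omega_hat *m diag_mx (Lambda i) *m Omega_hat :: hats_of s'
  else [::].

Definition B_hat (k : 'I_d) (i : nat) : 'M[R]_b :=
  nth 0 (hats_of (nodes k)) i.

(* The matrix S_{i,d}^(k): the value at B_i^(k) of
     (x I - B_hat_d) (x I - B_hat_(d-1)) ... (x I - B_hat_(i+1)),
   i.e. the recursion S := B_i S - S B_hat_j runs over j = d, d-1, ..., i+1.
   Since B_hat_i = S_{i,d}^-1 B_i S_{i,d}, this is the order for which
     F_k(x I) = (x I - B_hat_d) ... (x I - B_hat_2) (S_{1,d}^(k))^-1.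
   Run over j = i+1, ..., d with the factors multiplied in increasing order,
   the product would not vanish at B_d^(k) in general as soon as d >= 3: for
   d = 3 its value there is B_hat_2 B_hat_3 - B_hat_3 B_hat_2. *)
Definition S_mx (k : 'I_d) (i : nat) : 'M[R]_b :=
  factor_eval (drop i.+1 (hats_of (nodes k))) (B (node k i)).

Definition Omega_hat (k : 'I_d) (i : nat) : 'M[R]_b :=
  Omega (node k i) *m S_mx k i.

Lemma filter_neq_enum (k : 'I_d) :
  [seq val i | i <- enum 'I_d & i != k] = iota 0 k ++ iota k.+1 (d - k.+1).
Proof.
transitivity [seq i <- map val (enum 'I_d) | i != k :> nat].
  by rewrite filter_map.
have -> : map val (enum 'I_d) = iota 0 k ++ (k : nat) :: iota k.+1 (d - k.+1).
  have e : d = (k + (d - k.+1).+1)%N by rewrite -addSnnS subnKC.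
  by rewrite val_enum_ord [in LHS]e iotaD.
rewrite filter_cat /= eqxx /=; congr (_ ++ _); apply/all_filterP/allP => i.
  by rewrite mem_iota /= add0n neq_ltn => ->.
by rewrite mem_iota neq_ltn => /andP[-> _]; rewrite orbT.
Qed.

Lemma size_nodes k : size (nodes k) = d.
Proof.
have := congr1 size (filter_neq_enum k).
by rewrite size_map size_cat !size_iota /= => ->; rewrite -addSn subnKC.
Qed.

Lemma val_node k i : (i < d)%N ->
  node k i = (if i == 0 then k : nat else if i <= k then i.-1 else i)%N :> nat.
Proof.
case: i => [|i] //= lt_id.
have lt_sz : (i < size [seq i <- enum 'I_d | i != k])%N.
  by rewrite -ltnS; have /= -> := size_nodes k.
rewrite /node /= -(nth_map k 0%N val) // filter_neq_enum nth_cat size_iota.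
case: ltnP => h; first by rewrite nth_iota.
by rewrite nth_iota ?ltn_subRL addSn subnKC.
Qed.

Lemma hats_of_nth (k0 : 'I_d) s i : (i < size s)%N ->
  let O := Omega (nth k0 s i)
             *m factor_eval (drop i.+1 (hats_of s)) (B (nth k0 s i)) in
  nth 0 (hats_of s) i = invmx O *m diag_mx (Lambda (nth k0 s i)) *m O.
Proof. by elim: s i => [|j s IHs] [|i] //= lt_is; rewrite ?drop0 ?IHs. Qed.

Lemma B_hatE k i : (i < d)%N ->
  B_hat k i =
    invmx (Omega_hat k i) *m diag_mx (Lambda (node k i)) *m Omega_hat k i.
Proof. by move=> lt_id; apply: hats_of_nth; rewrite size_nodes. Qed.

Variables lmin lmax : R.

(* A denominator vanishes only when Lambda_i is a scalar matrix, in which case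
   the numerator vanishes as well and the quotient 0 / 0 = 0 is absorbed by the
   third term of the maximum, the initial value 1. *)
Definition chi_mono_at (k : 'I_d) : R :=
  \big[Num.max/1]_(1 <= i < d)
    Num.max
      (spectral_norm (lmin%:M - B_hat k i)
         / spectral_norm (lmin%:M - diag_mx (Lambda (node k i))))
      (spectral_norm (lmax%:M - B_hat k i)
         / spectral_norm (lmax%:M - diag_mx (Lambda (node k i)))).

(* For d >= 2 and b >= 1 this infimum and the one in spectral_gap are taken over
   finite nonempty sets, hence are minima. *)
Definition chi_coef_at (k : 'I_d) : R :=
  spectral_norm (invmx (S_mx k 0)) `^ (d.-1%:R^-1)
  * inf [set x | exists (i : 'I_d) (p q : 'I_b), (0 < i)%N /\
           x = `|Lambda (node k 0) 0 p - Lambda (node k i) 0 q| ].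

Definition chi_mono : R := \big[Num.max/0]_(k < d) chi_mono_at k.

Definition chi_coef : R := \big[Num.max/0]_(k < d) chi_coef_at k.

Definition spectral_gap : R :=
  inf [set x | exists (i j : 'I_d) (p q : 'I_b), i != j /\
         x = `|Lambda i 0 p - Lambda j 0 q| ].

End Construction.

(* Main.v *)
(* A matrix polynomial of degree less than d is determined by its values at
   B_1, ..., B_d, because its stacked coefficients are recovered from these
   values by inverting Van; this gives the interpolation formula and the product
   expression of F_k. For l > lmax,
     ||l I - B_hat|| <= (l - lmax) + ||lmax I - B_hat||
                     <= (l - lmax) + chi_mono (lmax - lmin)
                     <= chi_mono (l - lmin),
   since chi_mono >= 1, and symmetrically for l < lmin; multiplying the d - 1
   factors yields the growth bound. *)

Require Import Defs.
From HB Require Import structures.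
From mathcomp Require Import all_boot all_order all_algebra.
From mathcomp Require Import ring lra.
From mathcomp Require Import classical_sets set_interval reals exp.

Set Implicit Arguments.
Unset Strict Implicit.
Unset Printing Implicit Defensive.

Import Order.TTheory GRing.Theory Num.Theory.

Local Open Scope classical_set_scope.
Local Open Scope ring_scope.

(** * The Euclidean norm and the spectral norm as its operator norm *)

Section SpectralNorm.
Variable R : realType.

(** A sum of squares [(s * f i - t * g i) ^+ 2] is nonnegative; the choice [s = D], [t = C] turns
    this into [D * (A * D - C ^+ 2) >= 0], and [D] is cancelled when it is nonzero. *)
Lemma cauchy_schwarz_sum (I : finType) (f g : I -> R) :
  (\sum_i f i * g i) ^+ 2 <= (\sum_i f i ^+ 2) * (\sum_i g i ^+ 2).
Proof.
set C := \sum_i f i * g i; set A := \sum_i f i ^+ 2; set D := \sum_i g i ^+ 2.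
have A_ge0 : 0 <= A by apply: sumr_ge0 => i _; apply: sqr_ge0.
have D_ge0 : 0 <= D by apply: sumr_ge0 => i _; apply: sqr_ge0.
have expand s t : \sum_i (s * f i - t * g i) ^+ 2
    = s ^+ 2 * A - s * t * C *+ 2 + t ^+ 2 * D.
  rewrite /A /C /D !mulr_sumr -sumrMnl -sumrB -big_split /=.
  by apply: eq_bigr => i _; ring.
have expand_ge0 s t : 0 <= s ^+ 2 * A - s * t * C *+ 2 + t ^+ 2 * D.
  by rewrite -expand; apply: sumr_ge0 => i _; apply: sqr_ge0.
have [D0|D_neq0] := eqVneq D 0.
  have g0 i : g i = 0.
    apply/eqP; rewrite -sqrf_eq0.
    have /eqP := D0.
    rewrite psumr_eq0 => [/allP/(_ i)|j _]; last exact: sqr_ge0.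
    by rewrite mem_index_enum => /(_ isT).
  rewrite D0 mulr0 /C big1 ?expr0n // => i _.
  by rewrite g0 mulr0.
have D_gt0 : 0 < D by rewrite lt_neqAle eq_sym D_neq0.
rewrite -subr_ge0 -(pmulr_rge0 _ D_gt0).
by have := expand_ge0 D C; congr (0 <= _); ring.
Qed.

Lemma l2norm_ge0 n (x : 'cV[R]_n) : 0 <= l2norm x.
Proof. exact: sqrtr_ge0. Qed.

Lemma sqr_l2norm n (x : 'cV[R]_n) : l2norm x ^+ 2 = \sum_i x i 0 ^+ 2.
Proof. by rewrite sqr_sqrtr // sumr_ge0 // => i _; apply: sqr_ge0. Qed.

Lemma l2norm0 n : l2norm (0 : 'cV[R]_n) = 0.
Proof.
by rewrite /l2norm big1 ?sqrtr0 // => i _; rewrite mxE expr0n.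
Qed.

Lemma l2norm0_eq0 n (x : 'cV[R]_n) : l2norm x = 0 -> x = 0.
Proof.
move=> x0; apply/matrixP => i j; rewrite ord1 mxE.
have /eqP := sqr_l2norm x; rewrite x0 expr0n eq_sym.
rewrite psumr_eq0 => [/allP/(_ i)|k _]; last exact: sqr_ge0.
by rewrite mem_index_enum sqrf_eq0 => /(_ isT)/eqP.
Qed.

Lemma l2normZ n a (x : 'cV[R]_n) : l2norm (a *: x) = `|a| * l2norm x.
Proof.
rewrite -sqrtr_sqr -sqrtrM ?sqr_ge0 // mulr_sumr /l2norm.
by congr Num.sqrt; apply: eq_bigr => i _; rewrite mxE exprMn.
Qed.

Lemma ler_l2normD n (x y : 'cV[R]_n) : l2norm (x + y) <= l2norm x + l2norm y.
Proof.
have xy_ge0 : 0 <= l2norm x + l2norm y by rewrite addr_ge0 ?l2norm_ge0.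
rewrite -(@ler_pXn2r _ 2) ?nnegrE ?l2norm_ge0 // sqrrD !sqr_l2norm.
under eq_bigr do rewrite mxE sqrrD.
rewrite !big_split /= lerD2r lerD2l -mulr2n lerMn2r /=.
apply: le_trans (ler_norm _) _.
rewrite -(@ler_pXn2r _ 2) ?nnegrE ?mulr_ge0 ?l2norm_ge0 //.
by rewrite real_normK ?num_real // exprMn !sqr_l2norm cauchy_schwarz_sum.
Qed.

Lemma ler_l2norm_sum n (I : finType) (x : I -> 'cV[R]_n) :
  l2norm (\sum_i x i) <= \sum_i l2norm (x i).
Proof.
elim/big_rec2: _ => [|i a y _ le_ya]; first by rewrite l2norm0.
by apply: le_trans (ler_l2normD _ _) _; rewrite lerD2l.
Qed.

Lemma ler_norm_l2norm n (x : 'cV[R]_n) i : `|x i 0| <= l2norm x.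
Proof.
rewrite -(@ler_pXn2r _ 2) ?nnegrE ?l2norm_ge0 // real_normK ?num_real //.
rewrite sqr_l2norm (bigD1 i) //= lerDl sumr_ge0 // => j _; exact: sqr_ge0.
Qed.

(** A crude bound, used to show that the set defining [spectral_norm] is bounded above, so that its
    [sup] is a genuine supremum. *)
Lemma l2norm_mulmx_le m n (A : 'M[R]_(m, n)) (x : 'cV[R]_n) :
  l2norm (A *m x) <= (\sum_j l2norm (col j A)) * l2norm x.
Proof.
have -> : A *m x = \sum_j x j 0 *: col j A.
  apply/matrixP => i k; rewrite !mxE summxE ord1; apply: eq_bigr => j _.
  by rewrite !mxE mulrC.
apply: le_trans (ler_l2norm_sum _) _; rewrite mulr_suml.
apply: ler_sum => j _; rewrite l2normZ mulrC.
by rewrite ler_wpM2l ?l2norm_ge0 ?ler_norm_l2norm.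
Qed.

Lemma ler_mulmx_spectral_norm_unit m n (A : 'M[R]_(m, n)) (x : 'cV[R]_n) :
  l2norm x <= 1 -> l2norm (A *m x) <= spectral_norm A.
Proof.
move=> x_le1; apply: ub_le_sup; last by exists x.
exists (\sum_j l2norm (col j A)) => _ [y /= y_le1 <-].
apply: le_trans (l2norm_mulmx_le _ _) _.
by rewrite ler_piMr ?sumr_ge0 // => i _; apply: l2norm_ge0.
Qed.

Lemma spectral_norm_ge0 m n (A : 'M[R]_(m, n)) : 0 <= spectral_norm A.
Proof.
apply: le_trans (l2norm_ge0 (A *m 0)) _.
by apply: ler_mulmx_spectral_norm_unit; rewrite l2norm0.
Qed.

Lemma ler_mulmx_spectral_norm m n (A : 'M[R]_(m, n)) (x : 'cV[R]_n) :
  l2norm (A *m x) <= spectral_norm A * l2norm x.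
Proof.
have [x0|x_neq0] := eqVneq (l2norm x) 0.
  by rewrite (l2norm0_eq0 x0) mulmx0 !l2norm0 mulr0.
have x_gt0 : 0 < l2norm x by rewrite lt_neqAle eq_sym x_neq0 l2norm_ge0.
rewrite -ler_pdivrMr // mulrC -[X in X * _]ger0_norm ?invr_ge0 ?l2norm_ge0 //.
rewrite -l2normZ scalemxAr ler_mulmx_spectral_norm_unit // l2normZ.
by rewrite ger0_norm ?invr_ge0 ?l2norm_ge0 // mulVf.
Qed.

Lemma spectral_norm_le m n (A : 'M[R]_(m, n)) c : 0 <= c ->
  (forall x, l2norm (A *m x) <= c * l2norm x) -> spectral_norm A <= c.
Proof.
move=> c_ge0 le_Ac; apply: ge_sup.
  by exists (l2norm (A *m 0)), 0; rewrite //= l2norm0.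
move=> _ [x /= x_le1 <-]; apply: le_trans (le_Ac x) _.
by rewrite ler_piMr.
Qed.

(** Each column is the image of a basis vector. This settles the quotients in [chi_mono_at] whose
    denominator is zero. *)
Lemma spectral_norm0_eq0 m n (A : 'M[R]_(m, n)) : spectral_norm A = 0 -> A = 0.
Proof.
move=> A0; suff cA0 j : col j A = 0.
  by apply/matrixP => i j; have /matrixP/(_ i 0) := cA0 j; rewrite !mxE.
rewrite colE; apply: l2norm0_eq0; apply/eqP; rewrite eq_le l2norm_ge0 andbT.
by apply: le_trans (ler_mulmx_spectral_norm _ _) _; rewrite A0 mul0r.
Qed.

Lemma ler_spectral_normD m n (A C : 'M[R]_(m, n)) :
  spectral_norm (A + C) <= spectral_norm A + spectral_norm C.
Proof.
apply: spectral_norm_le => [|x]; first by rewrite addr_ge0 ?spectral_norm_ge0.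
rewrite mulmxDl mulrDl; apply: le_trans (ler_l2normD _ _) _.
by apply: lerD; apply: ler_mulmx_spectral_norm.
Qed.

Lemma ler_spectral_normM m n p (A : 'M[R]_(m, n)) (C : 'M[R]_(n, p)) :
  spectral_norm (A *m C) <= spectral_norm A * spectral_norm C.
Proof.
apply: spectral_norm_le => [|x]; first by rewrite mulr_ge0 ?spectral_norm_ge0.
rewrite -mulmxA -mulrA; apply: le_trans (ler_mulmx_spectral_norm _ _) _.
by rewrite ler_wpM2l ?spectral_norm_ge0 ?ler_mulmx_spectral_norm.
Qed.

Lemma spectral_norm_diag_le n (D : 'rV[R]_n) c : 0 <= c ->
  (forall p, `|D 0 p| <= c) -> spectral_norm (diag_mx D) <= c.
Proof.
move=> c_ge0 le_Dc; apply: spectral_norm_le => // x.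
rewrite -(@ler_pXn2r _ 2) ?nnegrE ?mulr_ge0 ?l2norm_ge0 // exprMn !sqr_l2norm.
rewrite mulr_sumr; apply: ler_sum => i _; rewrite mul_diag_mx mxE exprMn.
by rewrite ler_wpM2r ?sqr_ge0 // -(real_normK (num_real _)) ler_pXn2r ?nnegrE.
Qed.

Lemma spectral_norm_scalar_le n (a : R) : spectral_norm (a%:M : 'M_n) <= `|a|.
Proof.
rewrite -diag_const_mx; apply: spectral_norm_diag_le => // p.
by rewrite mxE.
Qed.

Lemma sqr_l2norm_mxcol d b (x : 'I_d -> 'cV[R]_b) :
  l2norm (\mxcol_k x k) ^+ 2 = \sum_k l2norm (x k) ^+ 2.
Proof.
(* Written as a product of a row by a column, the squared norm of a stacked vector splits by block
   multiplication. *)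
have sqrE n (y : 'cV[R]_n) : l2norm y ^+ 2 = (y^T *m y) 0 0.
  by rewrite sqr_l2norm mxE; apply: eq_bigr => i _; rewrite mxE.
rewrite sqrE tr_mxcol mul_mxrow_mxcol summxE.
by apply: eq_bigr => k _; rewrite sqrE.
Qed.

(** The factor [Num.sqrt d%:R] is the cost of passing from the sum of the norms of the blocks
    [C k *m x] to the norm of the stacked vector. *)
Lemma spectral_norm_sum_mxcol_le d b (A C : 'I_d -> 'M[R]_b) :
  spectral_norm (\sum_k A k *m C k)
    <= Num.sqrt d%:R * spectral_norm (\mxcol_k C k)
       * \big[Num.max/0]_k spectral_norm (A k).
Proof.
set M := \big[Num.max/0]_k spectral_norm (A k).
have M_ge0 : 0 <= M by apply: bigmax_ge_id.
apply: spectral_norm_le => [|x].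
  by rewrite !mulr_ge0 ?sqrtr_ge0 ?spectral_norm_ge0.
rewrite mulmx_suml; apply: le_trans (ler_l2norm_sum _) _.
have sum_le : \sum_k l2norm (C k *m x)
    <= Num.sqrt d%:R * (spectral_norm (\mxcol_k C k) * l2norm x).
  apply: (@le_trans _ _ (Num.sqrt d%:R * l2norm (\mxcol_k C k *m x))).
    rewrite -(@ler_pXn2r _ 2) ?nnegrE ?mulr_ge0 ?sqrtr_ge0 ?l2norm_ge0 //;
      last by apply: sumr_ge0 => k _; apply: l2norm_ge0.
    rewrite exprMn sqr_sqrtr // mxcol_mul sqr_l2norm_mxcol.
    (* Cauchy-Schwarz against the constant 1, whose squares sum to [d]. *)
    have := cauchy_schwarz_sum (fun=> 1) (fun k => l2norm (C k *m x)).
    under eq_bigr do rewrite mul1r.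
    by under [X in _ <= X * _]eq_bigr do rewrite expr1n;
      rewrite sumr_const card_ord.
  by rewrite ler_wpM2l ?sqrtr_ge0 ?ler_mulmx_spectral_norm.
rewrite [leRHS](_ : _ = M * (Num.sqrt d%:R
    * (spectral_norm (\mxcol_k C k) * l2norm x))); last by ring.
apply: (@le_trans _ _ (M * \sum_k l2norm (C k *m x))); last exact: ler_wpM2l.
rewrite mulr_sumr; apply: ler_sum => k _; rewrite -mulmxA.
apply: le_trans (ler_mulmx_spectral_norm _ _) _.
by rewrite ler_wpM2r ?l2norm_ge0 // /M le_bigmax.
Qed.

End SpectralNorm.

(** * Matrix polynomials: closure properties, interpolation, evaluation of products *)

Section MatrixPolynomials.
Variables (R : realType) (b : nat).
Implicit Types (P Q : 'M[R]_b -> 'M[R]_b) (A X : 'M[R]_b).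

Lemma matrix_poly_cst A : matrix_poly 0 (fun=> A).
Proof. by exists (fun=> A) => X; rewrite big_ord1 expr0 mul1mx. Qed.

Lemma matrix_poly_widen r P : matrix_poly r P -> matrix_poly r.+1 P.
Proof.
(* [unlift ord_max] is [None] only at the top index, which receives the coefficient 0. *)
case=> C PE; exists (fun i => oapp C 0 (unlift ord_max i)) => X.
rewrite big_ord_recr /= unlift_none mulmx0 addr0 PE.
apply: eq_bigr => i _; congr (_ *m _).
have -> : widen_ord (leqnSn r.+1) i = lift ord_max i.
  by apply: val_inj; rewrite [RHS]lift_max.
by rewrite liftK.
Qed.

Lemma matrix_polyXl r P :
  matrix_poly r P -> matrix_poly r.+1 (fun X => X *m P X).
Proof.
(* The coefficients move up by one index, and 0 becomes the constant term. *)
case=> C PE; exists (fun i => oapp C 0 (unlift ord0 i)) => X.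
rewrite big_ord_recl /= unlift_none mulmx0 add0r PE mulmx_sumr.
by apply: eq_bigr => i _; rewrite liftK exprS -mulmxE mulmxA.
Qed.

Lemma matrix_polyMr r P A :
  matrix_poly r P -> matrix_poly r (fun X => P X *m A).
Proof.
case=> C PE; exists (fun i => C i *m A) => X.
by rewrite PE mulmx_suml; apply: eq_bigr => i _; rewrite mulmxA.
Qed.

Lemma matrix_polyB r P Q :
  matrix_poly r P -> matrix_poly r Q -> matrix_poly r (fun X => P X - Q X).
Proof.
move=> [C PE] [D QE]; exists (fun i => C i - D i) => X.
by rewrite PE QE -sumrB; apply: eq_bigr => i _; rewrite mulmxBr.
Qed.

Lemma matrix_poly_sum r (I : finType) (P : I -> 'M[R]_b -> 'M[R]_b) :
  (forall k, matrix_poly r (P k)) -> matrix_poly r (fun X => \sum_k P k X).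
Proof.
(* The coefficients of each [P k] are only known to exist; choice gathers them into one function of
   [k]. *)
move=> /boolp.choice[C PE]; exists (fun i => \sum_k C k i) => X.
under eq_bigr do rewrite PE.
by rewrite exchange_big; apply: eq_bigr => i _; rewrite mulmx_sumr.
Qed.

Lemma matrix_poly_inj d (B : 'I_d.+1 -> 'M[R]_b) P Q :
  block_vandermonde B \in unitmx -> matrix_poly d P -> matrix_poly d Q ->
  (forall j, P (B j) = Q (B j)) -> P =1 Q.
Proof.
move=> VanU [C PE] [D QE] PQ X; rewrite PE QE.
suff /eq_mxcolP CD : \mxcol_i C i = \mxcol_i D i.
  by apply: eq_bigr => i _; rewrite CD.
(* With coefficients on the right, [block_vandermonde B] times the stacked coefficients is the stack
   of values at the [B i]. *)
apply: (can_inj (mulKmx VanU)); rewrite !mul_mxblock_mxrow.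
by apply/eq_mxcolP => i; rewrite -PE -QE.
Qed.

(** Multiplying [F k] on the right by the constant [P (B k)] keeps it a matrix polynomial, and at
    [B j] only the term [k = j] of the sum survives; equality at the nodes is enough. *)
Lemma fundamental_interpolation d (B : 'I_d.+1 -> 'M[R]_b) F P :
  block_vandermonde B \in unitmx -> fundamental B F -> matrix_poly d P ->
  forall X, P X = \sum_k F k X *m P (B k).
Proof.
move=> VanU [Fpoly FB] Ppoly; apply: (matrix_poly_inj VanU Ppoly) => [|j].
  by apply: matrix_poly_sum => k; apply: matrix_polyMr; apply: Fpoly.
rewrite (bigD1 j) //= FB eqxx mul1mx big1 ?addr0 // => k /negPf kj.
by rewrite FB kj mul0mx.
Qed.

Lemma matrix_poly_factor_eval (s : seq 'M[R]_b) :
  matrix_poly (size s) (factor_eval s).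
Proof.
elim: s => [|A s IHs] /=; first exact: matrix_poly_cst.
apply: matrix_polyB; first exact: matrix_polyXl.
by apply: matrix_poly_widen; apply: matrix_polyMr.
Qed.

(** Since [l%:M] commutes with every matrix, each step of [factor_eval] at [l%:M] is a right
    multiplication by [l%:M - A], to which submultiplicativity applies. *)
Lemma spectral_norm_factor_eval_le (s : seq 'M[R]_b) (l c : R) :
  (forall A, A \in s -> spectral_norm (l%:M - A) <= c) ->
  spectral_norm (factor_eval s l%:M) <= c ^+ size s.
Proof.
elim: s => [|A s IHs] le_c /=.
  by apply: le_trans (spectral_norm_scalar_le _ _) _; rewrite normr1.
rewrite -scalar_mxC -mulmxBr; apply: le_trans (ler_spectral_normM _ _) _.
rewrite exprSr; apply: ler_pM; rewrite ?spectral_norm_ge0 //.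
  by apply: IHs => A' A's; rewrite le_c // inE A's orbT.
by rewrite le_c ?mem_head.
Qed.

End MatrixPolynomials.

(** * Vanishing of the products of hat factors at the nodes *)

Section Hats.
Variables (R : realType) (b d : nat).
Variables (B Omega : 'I_d -> 'M[R]_b) (Lambda : 'I_d -> 'rV[R]_b).
Hypothesis Omega_unit : forall i, Omega i \in unitmx.
Hypothesis B_diag :
  forall i, B i = invmx (Omega i) *m diag_mx (Lambda i) *m Omega i.

Local Notation hats := (hats_of Omega Lambda B).

Lemma size_hats_of s : size (hats s) = size s.
Proof. by elim: s => //= i s ->. Qed.

(** Let [T] be the value at [B j] of the factors absorbed before node [j]. The hat matrix of [j] is
    the conjugate [invmx T *m B j *m T], so its factor gives [B j *m T - B j *m T = 0]. At the nodes
    treated earlier the value is already 0 and stays so, as [X *m S - S *m A] is linear in [S]. *)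
Lemma factor_eval_hats_of_eq0 (k0 : 'I_d) s :
  (forall p, (p < size s)%N ->
     factor_eval (drop p.+1 (hats s)) (B (nth k0 s p)) \in unitmx) ->
  forall i, i \in s -> factor_eval (hats s) (B i) = 0.
Proof.
elim: s => [|j s IHs] //= S_unit i; rewrite inE.
have [->|_] /= := eqVneq i j; last first.
  move=> i_s; rewrite IHs ?mulmx0 ?mul0mx ?subrr // => p lt_ps.
  exact: (S_unit p.+1).
move=> _; have /= := S_unit 0%N isT; rewrite drop0.
set T := factor_eval _ _ => T_unit.
suff -> : T *m (invmx (Omega j *m T) *m diag_mx (Lambda j) *m (Omega j *m T))
    = B j *m T by rewrite subrr.
apply: (can_inj (mulKmx (Omega_unit j))).
rewrite !mulmxA mulmxV ?unitmx_mul ?Omega_unit // mul1mx.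
by rewrite B_diag !mulmxA mulmxV // mul1mx.
Qed.

(** Row [p] of [Omega i] is a left eigenvector of [B i], nonzero because [Omega i] is invertible.
    Hypotheses on spectra thereby pass to the entries of [Lambda]. *)
Lemma eigenvalue_diag i p : spectrum (B i) (Lambda i 0 p).
Proof.
rewrite /spectrum /=; apply/eigenvalueP; exists (row p (Omega i)).
  rewrite B_diag !mulmxA -row_mul mulmxV // row1 -rowE row_diag_mx.
  by rewrite -scalemxAl -rowE.
apply/eqP => Om0; have := Omega_unit i; rewrite -row_free_unit => /row_freeP[C].
move=> /(congr1 (row p)); rewrite row_mul Om0 mul0mx row1 => /rowP/(_ p)/eqP.
by rewrite !mxE !eqxx eq_sym oner_eq0.
Qed.

End Hats.

(** * Estimates on the hat factors and on the spectral gap *)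

Section Bounds.
Variables (R : realType) (b d : nat).
Variables (B Omega : 'I_d -> 'M[R]_b) (Lambda : 'I_d -> 'rV[R]_b).
Variables (lmin lmax : R).
Hypothesis Omega_unit : forall i, Omega i \in unitmx.
Hypothesis B_diag :
  forall i, B i = invmx (Omega i) *m diag_mx (Lambda i) *m Omega i.
Hypothesis S_unit : forall i k : 'I_d, S_mx Omega Lambda B k i \in unitmx.
Hypothesis Lambda_cl : forall i p, lmin <= Lambda i 0 p <= lmax.

Lemma node_neq (k : 'I_d) i : (0 < i < d)%N -> node k i != k.
Proof.
move=> /andP[i_gt0 lt_id]; rewrite -val_eqE /= val_node // (gtn_eqF i_gt0).
by case: leqP => [le_ik|lt_ki]; [rewrite ltn_eqF ?prednK | rewrite gtn_eqF].
Qed.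

(* The quotient is 0 / 0 when [Lambda] is the scalar matrix [a%:M]; then
   [B_hat] is [a%:M] too, so the bound survives the junk value. *)
Lemma spectral_norm_B_hat_le (k : 'I_d) i a c : (i < d)%N ->
  spectral_norm (a%:M - B_hat Omega Lambda B k i)
    / spectral_norm (a%:M - diag_mx (Lambda (node k i))) <= c ->
  spectral_norm (a%:M - B_hat Omega Lambda B k i)
    <= c * spectral_norm (a%:M - diag_mx (Lambda (node k i))).
Proof.
move=> lt_id; set L := a%:M - diag_mx _.
have [L0|L_neq0] := eqVneq (spectral_norm L) 0; last first.
  by rewrite ler_pdivrMr // lt_neqAle eq_sym L_neq0 spectral_norm_ge0.
move=> _; rewrite B_hatE //.
have /eqP := spectral_norm0_eq0 L0; rewrite subr_eq0 => /eqP <-.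
have Oh_unit : Omega_hat Omega Lambda B k i \in unitmx.
  by rewrite unitmx_mul Omega_unit (S_unit (Ordinal lt_id)).
rewrite -mulmxA -scalar_mxC mulmxA mulVmx // mul1mx subrr L0 mulr0.
by have := spectral_norm_scalar_le b (0 : R); rewrite raddf0 normr0.
Qed.

Lemma chi_mono_at_ge1 k : 1 <= chi_mono_at Omega Lambda B lmin lmax k.
Proof. exact: bigmax_ge_id. Qed.

Lemma chi_mono_at_ge k i (chi := chi_mono_at Omega Lambda B lmin lmax k) :
  (0 < i < d)%N ->
  spectral_norm (lmin%:M - B_hat Omega Lambda B k i)
    <= chi * spectral_norm (lmin%:M - diag_mx (Lambda (node k i))) /\
  spectral_norm (lmax%:M - B_hat Omega Lambda B k i)
    <= chi * spectral_norm (lmax%:M - diag_mx (Lambda (node k i))).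
Proof.
move=> i_bnd; have /andP[_ lt_id] := i_bnd.
have := @le_bigmax_seq _ R _ (index_iota 1 d) 1 i xpredT
  (fun i => Num.max (spectral_norm (lmin%:M - B_hat Omega Lambda B k i)
         / spectral_norm (lmin%:M - diag_mx (Lambda (node k i))))
      (spectral_norm (lmax%:M - B_hat Omega Lambda B k i)
         / spectral_norm (lmax%:M - diag_mx (Lambda (node k i))))).
rewrite mem_index_iota => /(_ i_bnd isT); rewrite ge_max => /andP[le1 le2].
by split; apply: spectral_norm_B_hat_le.
Qed.

Lemma spectral_norm_shift_diag_le i a c : 0 <= c ->
  (forall p, `|a - Lambda i 0 p| <= c) ->
  spectral_norm (a%:M - diag_mx (Lambda i)) <= c.
Proof.
move=> c_ge0 le_c; rewrite -diag_const_mx -[_ - _]raddfB /=.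
by apply: spectral_norm_diag_le => // p; rewrite !mxE.
Qed.

Lemma factor_B_hat_le k i l : lmin <= lmax -> l \notin `[lmin, lmax] ->
  (0 < i < d)%N ->
  spectral_norm (l%:M - B_hat Omega Lambda B k i)
    <= Num.max (lmax - l) (l - lmin) * chi_mono_at Omega Lambda B lmin lmax k.
Proof.
move=> lminmax l_out i_bnd; have [B_min B_max] := chi_mono_at_ge k i_bnd.
have chi1 := chi_mono_at_ge1 k.
set chi := chi_mono_at _ _ _ _ _ _ in B_min B_max chi1 *.
have chi0 : 0 <= chi by apply: le_trans chi1.
(* Below, [a] is the endpoint nearer to [l]: then [|l - a|] and [lmax - lmin] add up to the distance
   from [l] to the far endpoint. *)
have split_norm a : spectral_norm (l%:M - B_hat Omega Lambda B k i)
    <= `|l - a| + spectral_norm (a%:M - B_hat Omega Lambda B k i).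
  rewrite -[l in l%:M](subrK a) raddfD -addrA.
  apply: le_trans (ler_spectral_normD _ _) _.
  by rewrite lerD2r spectral_norm_scalar_le.
have w_ge0 : 0 <= lmax - lmin by rewrite subr_ge0.
have [l_lt|l_gt] : l < lmin \/ lmax < l.
  by move: l_out; rewrite in_itv /= negb_and -!ltNge => /orP.
- apply: (@le_trans _ _ ((lmax - l) * chi)); last first.
    by rewrite ler_wpM2r // le_max lexx.
  apply: le_trans (split_norm lmin) _; rewrite ltr0_norm ?subr_lt0 //.
  have L_le : spectral_norm (lmin%:M - diag_mx (Lambda (node k i)))
      <= lmax - lmin.
    apply: spectral_norm_shift_diag_le => // p.
    have /andP[ge le] := Lambda_cl (node k i) p.
    by rewrite ler0_norm ?subr_le0 // opprB lerD2r.
  (* The remaining slack is [(chi - 1) * (lmin - l)], a product of nonnegative factors. *)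
  have := ler_wpM2l chi0 L_le; nra.
- apply: (@le_trans _ _ ((l - lmin) * chi)); last first.
    by rewrite ler_wpM2r // le_max lexx orbT.
  apply: le_trans (split_norm lmax) _; rewrite gtr0_norm ?subr_gt0 //.
  have L_le : spectral_norm (lmax%:M - diag_mx (Lambda (node k i)))
      <= lmax - lmin.
    apply: spectral_norm_shift_diag_le => // p.
    have /andP[ge le] := Lambda_cl (node k i) p.
    by rewrite ger0_norm ?subr_ge0 // lerD2l lerN2.
  have := ler_wpM2l chi0 L_le; nra.
Qed.

Lemma spectral_gap_gt0 :
  (0 < b)%N -> (1 < d)%N ->
  (forall i j p q, i != j -> Lambda i 0 p != Lambda j 0 q) ->
  0 < spectral_gap Lambda.
Proof.
move=> b_gt0 d_gt1 Lambda_neq.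
pose gap (t : 'I_d * 'I_d * 'I_b * 'I_b) :=
  let: (i, j, p, q) := t in `|Lambda i 0 p - Lambda j 0 q|.
(* The initial value 1 may push [m] below the true minimum, which is harmless: only a positive lower
   bound of the set is wanted. *)
pose m := \big[Num.min/1]_(t | t.1.1.1 != t.1.1.2) gap t.
have m_gt0 : 0 < m.
  rewrite /m; elim/big_ind: _ => // [x y x0 y0|[[[i j] p] q] /= ij].
    by rewrite lt_min x0.
  by rewrite normr_gt0 subr_eq0 Lambda_neq.
apply: lt_le_trans m_gt0 _; apply: lb_le_inf.
  pose i0 := Ordinal (ltnW d_gt1); pose i1 := Ordinal d_gt1.
  pose p0 := Ordinal b_gt0.
  by exists (gap (i0, i1, p0, p0)), i0, i1, p0, p0.
move=> _ [i [j [p [q [ij ->]]]]].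
exact: (@bigmin_le_cond _ _ _ _ (i, j, p, q)
  (fun t => t.1.1.1 != t.1.1.2) gap).
Qed.

(** The infimum in [chi_coef_at] runs over the pairs that pit node [k] against another node, a
    subset of the pairs in [spectral_gap], so it is at least as large. *)
Lemma spectral_gap_le_chi_coef (k : 'I_d) :
  (0 < b)%N -> (1 < d)%N ->
  spectral_norm (invmx (S_mx Omega Lambda B k 0)) `^ (d.-1%:R^-1)
    * spectral_gap Lambda <= chi_coef Omega Lambda B.
Proof.
move=> b_gt0 d_gt1.
apply: (@le_trans _ _ (chi_coef_at Omega Lambda B k)); last exact: le_bigmax.
rewrite ler_wpM2l ?powR_ge0 //; apply: lb_le_inf.
  by eexists; exists (Ordinal d_gt1), (Ordinal b_gt0), (Ordinal b_gt0).
move=> _ [i [p [q [i_gt0 ->]]]]; apply: ge_inf.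
  by exists 0 => _ [? [? [? [? [_ ->]]]]].
exists (node k 0), (node k i), p, q; split => //.
by rewrite eq_sym node_neq // i_gt0 /=.
Qed.

End Bounds.

(** * The product expression of [F k] and the final estimates *)

(* Both sides agree at every [B j]: the product vanishes at the nodes other than
   [B k], and takes the value [S_mx k 0] at [B k]. *)
Lemma fundamental_product (R : realType) (b d : nat)
  (B Omega : 'I_d.+1 -> 'M[R]_b) (Lambda : 'I_d.+1 -> 'rV[R]_b)
  (F : 'I_d.+1 -> 'M[R]_b -> 'M[R]_b) (k : 'I_d.+1) :
  (forall i, Omega i \in unitmx) ->
  (forall i, B i = invmx (Omega i) *m diag_mx (Lambda i) *m Omega i) ->
  (forall i k : 'I_d.+1, S_mx Omega Lambda B k i \in unitmx) ->
  block_vandermonde B \in unitmx -> fundamental B F ->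
  forall X, F k X = factor_eval (behead (hats_of Omega Lambda B (nodes k))) X
                      *m invmx (S_mx Omega Lambda B k 0).
Proof.
move=> Omega_unit B_diag S_unit VanU [Fpoly FB].
set s := [seq i <- enum 'I_d.+1 | i != k].
have size_s : size s = d by have [] := size_nodes k.
apply: (matrix_poly_inj VanU (Fpoly k)) => [|j].
  apply: matrix_polyMr => /=; rewrite -{1}size_s.
  by rewrite -(size_hats_of B Omega Lambda); apply: matrix_poly_factor_eval.
rewrite FB; have [<-|kj] := eqVneq k j.
  (* Dropping the head of the hats leaves exactly the factors of [S_mx] at position 0, whose node is
     [k]. *)
  have := S_unit ord0 k; rewrite /S_mx /= drop0 => SU.
  by rewrite mulmxV.
rewrite /= (factor_eval_hats_of_eq0 Omega_unit B_diag (k0 := k)) ?mul0mx //.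
  move=> p; rewrite size_s => lt_pd.
  (* Removing the head [k] shifts positions: [p] in [s] is [p.+1] in [nodes k]. *)
  exact: (S_unit (Ordinal (lt_pd : p.+1 < d.+1)%N) k).
by rewrite mem_filter eq_sym kj mem_enum.
Qed.

Theorem theorem2 (R : realType) (b d : nat) (b_gt0 : (0 < b)%N)
  (d_gt0 : (0 < d)%N)
  (Phi : 'M[R]_b -> 'M[R]_b) (hPhi : matrix_poly d.-1 Phi)
  (B Omega : 'I_d -> 'M[R]_b) (Lambda : 'I_d -> 'rV[R]_b) (lmin lmax : R)
  (hOmega : forall i, Omega i \in unitmx)
  (hB : forall i, B i = invmx (Omega i) *m diag_mx (Lambda i) *m Omega i)
  (hdisj : forall i j, i != j -> spectrum (B i) `&` spectrum (B j) = set0)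
  (hcl : forall i, spectrum (B i) `<=` [set` `[lmin, lmax]])
  (hVan : block_vandermonde B \in unitmx)
  (F : 'I_d -> 'M[R]_b -> 'M[R]_b) (hF : fundamental B F) :
  (forall l : R, Phi l%:M = \sum_(k < d) F k l%:M *m Phi (B k))
  /\
  ((forall i k : 'I_d, S_mx Omega Lambda B k i \in unitmx) ->
   forall l : R, l \notin `[lmin, lmax] ->
     spectral_norm (Phi l%:M)
       <= Num.sqrt d%:R * spectral_norm (\mxcol_(k < d) Phi (B k))
          * \big[Num.max/0]_(k < d) spectral_norm (F k l%:M)
     /\
     ((2 <= d)%N ->
      \big[Num.max/0]_(k < d) (spectral_norm (F k l%:M) `^ (d.-1%:R^-1))
        <= Num.max (lmax - l) (l - lmin) / spectral_gap Lambda
           * (chi_mono Omega Lambda B lmin lmax * chi_coef Omega Lambda B))).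

Proof.
(* Writing [d] as [n.+1] turns [d.-1] into [n] and makes [ord0] available. *)
case: d d_gt0 hPhi B Omega Lambda hOmega hB hdisj hcl hVan F hF => // n _ /=
  hPhi
  B Omega Lambda hOmega hB hdisj hcl hVan F hF.
have interp l := fundamental_interpolation hVan hF hPhi l%:M.
split=> // S_unit l l_out; split=> [|n_gt0].
  by rewrite interp spectral_norm_sum_mxcol_le.
have Lambda_cl i p : lmin <= Lambda i 0 p <= lmax.
  by have := hcl i _ (eigenvalue_diag hOmega hB i p); rewrite /= in_itv.
have Lambda_neq i j p q : i != j -> Lambda i 0 p != Lambda j 0 q.
  move=> /hdisj ij0; apply/eqP => Lij.
  suff : (spectrum (B i) `&` spectrum (B j)) (Lambda i 0 p) by rewrite ij0.
  by split; [|rewrite Lij]; apply: eigenvalue_diag hOmega hB _ _.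
have lminmax : lmin <= lmax.
  (* As [b] is positive, some eigenvalue lies in the interval, which is thus nonempty. *)
  by have /andP[] := Lambda_cl ord0 (Ordinal b_gt0); apply: le_trans.
have gap_gt0 := spectral_gap_gt0 b_gt0 n_gt0 Lambda_neq.
set M := Num.max (lmax - l) (l - lmin).
have M_ge0 : 0 <= M.
  move: l_out; rewrite in_itv /= negb_and -!ltNge le_max => /orP[l_lt|l_gt].
    by rewrite subr_ge0 ltW // (lt_le_trans l_lt).
  by rewrite orbC subr_ge0 ltW // (le_lt_trans lminmax).
have chi_ge0 k : 0 <= chi_mono_at Omega Lambda B lmin lmax k.
  exact: le_trans ler01 (chi_mono_at_ge1 _ _ _ _ _ _).
have chi_mono_ge0 : 0 <= chi_mono Omega Lambda B lmin lmax.
  exact: bigmax_ge_id.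
have chi_coef_ge0 : 0 <= chi_coef Omega Lambda B by exact: bigmax_ge_id.
apply: bigmax_le => [|k _].
  by rewrite !mulr_ge0 // invr_ge0 ltW.
have F_le : spectral_norm (F k l%:M)
    <= (M * chi_mono_at Omega Lambda B lmin lmax k) ^+ n
       * spectral_norm (invmx (S_mx Omega Lambda B k 0)).
  rewrite (fundamental_product k hOmega hB S_unit hVan hF).
  apply: le_trans (ler_spectral_normM _ _) _.
  rewrite ler_wpM2r ?spectral_norm_ge0 //.
  have size_hats : size (behead (hats_of Omega Lambda B (nodes k))) = n.
    by rewrite size_behead size_hats_of size_nodes.
  rewrite -[X in _ ^+ X]size_hats.
  (* Entry [i] of the tail is [B_hat k i.+1], a position within the range of [factor_B_hat_le]. *)
  apply: spectral_norm_factor_eval_le => A /(nthP 0)[i].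
  rewrite size_hats nth_behead => lt_in <-.
  exact: (factor_B_hat_le hOmega S_unit Lambda_cl k lminmax l_out).
set c := M * _ in F_le; have c_ge0 : 0 <= c by apply: mulr_ge0.
have n_neq0 : n%:R != 0 :> R by rewrite pnatr_eq0 -lt0n.
set nS := spectral_norm (invmx _) in F_le.
have nS_ge0 : 0 <= nS by apply: spectral_norm_ge0.
(* Taking [n]-th roots in [F_le] reduces [c ^+ n] to [c], since [n] is nonzero. *)
apply: (@le_trans _ _ (c * nS `^ n%:R^-1)).
  have := @ge0_ler_powR R n%:R^-1; rewrite invr_ge0 ler0n => /(_ isT).
  move=> /(_ _ _ _ _ F_le); rewrite !nnegrE spectral_norm_ge0.
  rewrite mulr_ge0 ?exprn_ge0 // => /(_ isT isT); rewrite powRM ?exprn_ge0 //.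
  by rewrite -[c ^+ n]powR_mulrn // -powRrM divff // powRr1.
(* Regrouped so that the two factors are bounded separately: [c] through the maximum [chi_mono], and
   the root of [nS] through [chi_coef] divided by the positive gap. *)
rewrite [leRHS](_ : _ = (M * chi_mono Omega Lambda B lmin lmax)
  * (chi_coef Omega Lambda B / spectral_gap Lambda)); last by ring.
apply: ler_pM; rewrite ?powR_ge0 //.
  by rewrite ler_wpM2l // le_bigmax.
by rewrite ler_pdivlMr // spectral_gap_le_chi_coef.
Qed.
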